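(* Let $X$ be a Banach space as described in the context and let $f\in X$. If there exists a sequence $p_n\in\mathcal{P}_n[\mathbb{Z}]$ with $\lim_{n\to\infty}\|f-p_n\|=0$, then all Taylor coefficients $c_k=\frac{f^{(k)}(0)}{k!}$ of $f$ are integers.
   Context: $\mathbb{D}=\{z\in\mathbb{C}:|z|<1\}$. $X$ is a complex Banach space of functions analytic in $\mathbb{D}$ whose norm $\|\cdot\|$ satisfies: (i) $\|f(\cdot\, e^{it})\|=\|f(\cdot)\|$ for all $t\in\mathbb{R}$ and $f\in X$; (ii) $\|f\|<\infty$ for every entire function $f$; (iii) for all $f\in X$ and $g\in L[0,2\pi]$, $\big\|\frac{1}{2\pi}\int_0^{2\pi} f(ze^{it})g(t)\,dt\big\|\le \frac{1}{2\pi}\int_0^{2\pi}|g(t)|\,dt\cdot\|f\|$. A complex number is called an integer if its real and imaginary parts are integers; $\mathcal{P}_n[\mathbb{Z}]$ is the set of complex polynomials of degree at most $n-1$ with integer coefficients in this sense. *)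

(* Defs.v *)
From HB Require Import structures.
From mathcomp Require Import all_boot all_order all_algebra.
From mathcomp Require Import all_classical all_reals all_analysis.
From mathcomp Require Import complex.
Import Order.TTheory GRing.Theory Num.Theory.
Import numFieldNormedType.Exports.
Set Implicit Arguments. Unset Strict Implicit. Unset Printing Implicit Defensive.
Local Open Scope ring_scope.
Local Open Scope complex_scope.

Section Defs.
Variable R : realType.

Definition udisk : set R[i] := [set z | `|z| < 1].

Definition holo_on (D : set R[i]) (f : R[i]^o -> R[i]^o) : Prop :=
  forall z, D z -> derivable f z 1.
Definition entire (f : R[i]^o -> R[i]^o) : Prop := forall z, derivable f z 1.

(* Gaussian integers: "a complex number is an integer" *)
Definition gauss_int (c : R[i]) : Prop :=
  exists a b : int, c = (a%:~R +i* b%:~R).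

Definition expi (t : R) : R[i] := (cos t +i* sin t).

Definition cintegrable (g : R -> R[i]) : Prop :=
  lebesgue_measure.-integrable `[0%R, pi *+ 2] (EFin \o (fun t => complex.Re (g t))) /\
  lebesgue_measure.-integrable `[0%R, pi *+ 2] (EFin \o (fun t => complex.Im (g t))).

Definition cint (h : R -> R[i]) : R[i] :=
  (Rintegral lebesgue_measure `[0%R, pi *+ 2] (fun t => complex.Re (h t)) +i*
   Rintegral lebesgue_measure `[0%R, pi *+ 2] (fun t => complex.Im (h t))).

Definition taylor_coef (f : R[i]^o -> R[i]^o) (k : nat) : R[i] :=
  derive1n k f 0 / (k`!)%:R.

Definition PnZ (n : nat) (p : {poly R[i]}) : Prop :=
  (size p <= n)%N /\ forall k, gauss_int p`_k.

(* A complex Banach space X realised (through E) as a space of functions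
   analytic in D, with norm satisfying (i), (ii), (iii). *)
Record analytic_banach_space (X : completeNormedModType R[i])
    (E : X -> R[i]^o -> R[i]^o) : Prop := {
  abs_add : forall x y z, udisk z -> E (x + y) z = E x z + E y z;
  abs_scale : forall (a : R[i]) x z, udisk z -> E (a *: x) z = a * E x z;
  abs_inj : forall x y, (forall z, udisk z -> E x z = E y z) -> x = y;
  abs_holo : forall x, holo_on udisk (E x);
  abs_rot : forall x (t : R), exists y : X,
    (forall z, udisk z -> E y z = E x (z * expi t)) /\ `|y| = `|x|;
  abs_entire : forall f, entire f -> exists x : X, forall z, udisk z -> E x z = f z;
  abs_conv : forall (x : X) (g : R -> R[i]), cintegrable g -> exists y : X,
    (forall z, udisk z ->
       E y z = (pi *+ 2)^-1%:C * cint (fun t => E x (z * expi t) * g t)) /\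
    `|y| <= (pi *+ 2)^-1%:C * cint (fun t => `|g t|) * `|x| }.

End Defs.

(* Main.v *)
(* Convolving with e^{-ikt} gives an operator T_k on X of norm at most 1; on a
   polynomial it extracts the monomial of degree k (and is 0 for k < 0).  Applied
   to f - p_n it shows that T_k f is the X-limit of Gaussian integer multiples of
   z^k, hence is itself such a multiple b_k z^k, and T_k f = 0 for k < 0.  So the
   Fourier coefficients of f on each circle |z| = r are b_k r^k for k >= 0 and 0
   for k < 0; they are bounded since f is continuous, so sum b_k z^k converges in
   the disk, and by uniqueness of Fourier coefficients of continuous functions it
   equals f.  This makes f a power series with Taylor coefficients b_k without
   any appeal to Cauchy's integral theorem. *)

Require Import Defs.
From HB Require Import structures.
From mathcomp Require Import all_boot all_order all_algebra.
From mathcomp Require Import all_classical all_reals all_analysis.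
From mathcomp Require Import complex ring lra.
Import Order.TTheory GRing.Theory Num.Theory.
Import numFieldNormedType.Exports.
Local Open Scope ring_scope.
Local Open Scope complex_scope.
Local Open Scope classical_set_scope.
Set Implicit Arguments.
Unset Strict Implicit.
Unset Printing Implicit Defensive.

(** * The real-valued modulus on the complex numbers *)

Section Modulus.
Variable R : realType.
Implicit Types (x y z w : R[i]) (r : R).
Local Notation normc := (@ComplexField.Normc.normc R).

Lemma normC_normc z : `|z| = (normc z)%:C.
Proof. by case: z. Qed.

Lemma normc_ge0 z : 0 <= normc z.
Proof. by case: z => a b; exact: sqrtr_ge0. Qed.

Lemma normcD z w : normc (z + w) <= normc z + normc w.
Proof. exact: le_normcD. Qed.

Lemma normc_distC z w : normc (z - w) = normc (w - z).
Proof. by rewrite -normcN opprB. Qed.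

Lemma normcM z w : normc (z * w) = normc z * normc w.
Proof. exact: ComplexField.Normc.normcM. Qed.

Lemma normcX z n : normc (z ^+ n) = normc z ^+ n.
Proof.
elim: n => [|n IH]; first exact: ComplexField.Normc.normc1.
by rewrite !exprS normcM IH.
Qed.

Lemma normc_real r : normc r%:C = `|r|.
Proof. by rewrite /= expr0n addr0 sqrtr_sqr. Qed.

Lemma normc_nat n : normc n%:R = n%:R.
Proof.
have -> : (n%:R : R[i]) = (n%:R : R)%:C by rewrite rmorph_nat.
by rewrite normc_real normr_nat.
Qed.

Lemma normc0 : normc 0 = 0.
Proof. exact: ComplexField.Normc.normc0. Qed.

Lemma normc_sum (I : finType) (P : pred I) (u : I -> R[i]) :
  normc (\sum_(i | P i) u i) <= \sum_(i | P i) normc (u i).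
Proof.
elim/big_rec2 : _ => [|i s1 s2 _ le12]; first by rewrite normc0.
by rewrite (le_trans (normcD _ _))// lerD2l.
Qed.

Lemma normc_Re z : `|complex.Re z| <= normc z.
Proof. by rewrite -lecR -normC_normc normc_ge_Re. Qed.

Lemma normc_Im z : `|complex.Im z| <= normc z.
Proof.
case: z => a b /=; rewrite -[leLHS]ger0_norm// -sqrtr_sqr ler_sqrt.
  by rewrite real_normK ?num_real// lerDr sqr_ge0.
by rewrite addr_ge0 ?sqr_ge0.
Qed.

Lemma normc_le_ReIm z : normc z <= `|complex.Re z| + `|complex.Im z|.
Proof.
rewrite -[leRHS]ger0_norm ?addr_ge0// -sqrtr_sqr; case: z => a b /=.
rewrite ler_sqrt ?sqr_ge0// sqrrD !real_normK ?num_real//.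
by rewrite lerD2r lerDl mulrn_wge0// mulr_ge0.
Qed.

Lemma normc_eq0 z : normc z = 0 -> z = 0.
Proof. exact: ComplexField.Normc.eq0_normc. Qed.

Lemma udiskE z : udisk z <-> normc z < 1.
Proof. by rewrite /udisk /= normC_normc ltcR. Qed.

End Modulus.


(** * Convergence of power series in the disk and their first-order Taylor remainders *)

Section PowerSeries.
Variable R : realType.
Local Notation C := R[i].
Local Notation normc := (@ComplexField.Normc.normc R).
Implicit Types (b : nat -> C) (z w : C) (F : C^o -> C^o).

Definition psum b z n : C := \sum_(k < n) b k * z ^+ k.

(** Radius of convergence at least 1 in the form of Abel's criterion: the terms stay bounded on
    every circle of radius below 1. *)
Definition subexp b : Prop := forall r : R, 0 <= r -> r < 1 ->
  exists M, forall k, normc (b k) * r ^+ k <= M.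

Definition sums_to b F : Prop := forall z, normc z < 1 ->
  normc (psum b z n - F z) @[n --> \oo] --> (0 : R).

Definition dcoef b : nat -> C := fun k => k.+1%:R * b k.+1.

Lemma between (r : R) : r < 1 -> exists2 s : R, r < s & s < 1.
Proof. by move=> r1; exists ((1 + r) / 2); lra. Qed.

Lemma subexp_shift b : subexp b -> subexp (fun k => b k.+1).
Proof.
move=> hb r r0 r1; have [s rs s1] := between r1.
have [||M hM] := hb s; [lra|exact: s1|].
have s0 : 0 < s by lra.
exists (M / s) => k; rewrite ler_pdivlMr//.
apply: le_trans (hM k.+1); rewrite exprSr mulrA. apply: ler_wpM2r; first exact: ltW.
by apply: ler_wpM2l; rewrite ?normc_ge0// lerXn2r ?nnegrE// ltW.
Qed.


Lemma bernoulli (x : R) k : 0 <= x -> 1 + k%:R * x <= (1 + x) ^+ k.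
Proof.
move=> x0; elim: k => [|k IH]; first by rewrite mul0r addr0 expr0.
rewrite exprSr; apply: (@le_trans _ _ ((1 + k%:R * x) * (1 + x))).
  rewrite -natr1; have : 0 <= k%:R * x * x by rewrite !mulr_ge0.
  lra.
by rewrite ler_wpM2r//; lra.
Qed.

(** A linear factor costs only a slightly larger radius: it is absorbed by [(t / s) ^+ k] for some
    [t > s > r]. *)
Lemma subexp_natmul b : subexp b -> subexp (fun k => k.+1%:R * b k).
Proof.
move=> hb r r0 r1; have [s rs s1] := between r1; have [t st t1] := between s1.
have s0 : 0 < s by lra.
have [||M hM] := hb t; [lra|lra|].
pose x := t / s - 1.
have x0 : 0 < x by rewrite /x subr_gt0 ltr_pdivlMr// mul1r.
exists ((1 + x^-1) * M) => k.
rewrite normcM normc_nat.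
(* Bernoulli with [1 + x = t / s]: expanding [(1 + x^-1) * (1 + k x)] produces [1 + k] plus
   nonnegative terms. *)
have kle : k.+1%:R <= (1 + x^-1) * (t / s) ^+ k.
  have -> : t / s = 1 + x by rewrite /x; lra.
  have xi0 : 0 < x^-1 by rewrite invr_gt0.
  apply: (@le_trans _ _ ((1 + x^-1) * (1 + k%:R * x))); last first.
    by rewrite ler_wpM2l ?bernoulli//; lra.
  have e : x^-1 * (k%:R * x) = k%:R by rewrite mulrCA mulVf ?gt_eqF// mulr1.
  have : 0 <= k%:R * x by rewrite mulr_ge0// ltW.
  rewrite -natr1; move: e xi0; move: (x^-1) (k%:R * x) => y kx e y0 kx0.
  by rewrite mulrDl mul1r mulrDr mulr1 e; lra.
apply: (@le_trans _ _ (k.+1%:R * normc (b k) * s ^+ k)).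
  rewrite ler_wpM2l ?mulr_ge0 ?normc_ge0// lerXn2r ?nnegrE//; lra.
apply: (@le_trans _ _ ((1 + x^-1) * (t / s) ^+ k * (normc (b k) * s ^+ k))).
  by rewrite -mulrA ler_wpM2r// mulr_ge0 ?normc_ge0// exprn_ge0// ltW.
rewrite expr_div_n -[leLHS]mulrA ler_wpM2l//.
  by rewrite addr_ge0// invr_ge0 ltW.
rewrite [X in X <= _](_ : _ = normc (b k) * t ^+ k)//.
by field; rewrite expf_neq0// gt_eqF.
Qed.

Lemma subexp_dcoef b : subexp b -> subexp (dcoef b).
Proof. by move=> /subexp_shift /subexp_natmul. Qed.

Lemma sum_geometric_le (q : R) n : 0 <= q -> q < 1 ->
  \sum_(k < n) q ^+ k <= (1 - q)^-1.
Proof.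
move=> q0 q1; rewrite -[leRHS]mul1r ler_pdivlMr ?subr_gt0//.
have := subrX1 q n => /eqP; rewrite -subr_eq0 => /eqP h.
have : 0 <= q ^+ n by rewrite exprn_ge0.
lra.
Qed.

(** The terms at an intermediate radius [s] are at most [M], so those at [r] are dominated by a
    geometric series of ratio [r / s]. *)
Lemma subexp_abs_sum b (r : R) : subexp b -> 0 <= r -> r < 1 ->
  exists c, forall n, \sum_(k < n) normc (b k) * r ^+ k <= c.
Proof.
move=> hb r0 r1; have [s rs s1] := between r1.
have s0 : 0 < s by lra.
have [||M hM] := hb s; [lra|lra|].
have M0 : 0 <= M by apply: le_trans (hM 0); rewrite mulr_ge0 ?normc_ge0.
exists (M * (1 - r / s)^-1) => n.
apply: (@le_trans _ _ (M * \sum_(k < n) (r / s) ^+ k)); last first.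
  apply: ler_wpM2l => //; apply: sum_geometric_le; first by rewrite divr_ge0// ltW.
  by rewrite ltr_pdivrMr// mul1r.
rewrite mulr_sumr; apply: ler_sum => k _.
rewrite expr_div_n mulrA ler_pdivlMr ?exprn_gt0//.
by rewrite mulrAC ler_wpM2r ?exprn_ge0.
Qed.

(** Real and imaginary parts are real series dominated by the absolute sums, hence each converges
    absolutely. *)
Lemma psum_cvg b z : subexp b -> normc z < 1 ->
  exists s, normc (psum b z n - s) @[n --> \oo] --> (0 : R).
Proof.
move=> hb z1; have [|c hc] := subexp_abs_sum hb _ z1; first exact: normc_ge0.
have cv (u : nat -> R) : (forall k, `|u k| <= normc (b k) * normc z ^+ k) ->
    cvgn (series u).
  move=> hu; apply: normed_cvg; apply: nondecreasing_is_cvgn.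
    by apply/nondecreasing_seqP => n; rewrite /= seriesS lerDr.
  exists c => _ [n _ <-]; rewrite /= seriesEord /=; apply: le_trans (hc n).
  exact: ler_sum.
have /cvg_ex [l1 hl1] : cvgn (series (fun k => complex.Re (b k * z ^+ k))).
  by apply: cv => k; rewrite -normcX -normcM normc_Re.
have /cvg_ex [l2 hl2] : cvgn (series (fun k => complex.Im (b k * z ^+ k))).
  by apply: cv => k; rewrite -normcX -normcM normc_Im.
exists (l1 +i* l2).
have psumE n : psum b z n = series (fun k => complex.Re (b k * z ^+ k)) n
    +i* series (fun k => complex.Im (b k * z ^+ k)) n.
  rewrite /psum /series /= !big_mkord; elim: n => [|n IH]; first by rewrite !big_ord0.
  by rewrite !big_ord_recr /= IH; case: (b n * _).
apply: (@squeeze_cvgr _ _ _ _ (cst 0) (fun n =>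
  `|series (fun k => complex.Re (b k * z ^+ k)) n - l1| +
  `|series (fun k => complex.Im (b k * z ^+ k)) n - l2|)).
- near=> n; rewrite normc_ge0 /=; apply: le_trans (normc_le_ReIm _) _.
  by rewrite psumE.
- exact: cvg_cst.
- rewrite -[X in _ --> X]addr0; apply: cvgD; rewrite -(@normr0 _ R); apply: cvg_norm; exact/subr_cvg0.
Unshelve. all: by end_near. Qed.

(** First-order Taylor remainder at [z] of the power with exponent [k.+1]; the shift keeps the
    exponent [k] of the derivative free of predecessors. *)
Definition taylor1_pow z w k : C := w ^+ k.+1 - z ^+ k.+1 - k.+1%:R * z ^+ k * (w - z).

Lemma taylor1_powS z w k :
  taylor1_pow z w k.+1 = z * taylor1_pow z w k + (w ^+ k.+1 - z ^+ k.+1) * (w - z).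
Proof. by rewrite /taylor1_pow -(natr1 k.+1) !exprS; ring. Qed.

Lemma normc_subXX z w (r : R) k : normc z <= r -> normc w <= r ->
  normc (w ^+ k.+1 - z ^+ k.+1) <= k.+1%:R * r ^+ k * normc (w - z).
Proof.
move=> zr wr; have r0 : 0 <= r := le_trans (normc_ge0 _) zr.
rewrite subrXX normcM mulrC ler_wpM2r ?normc_ge0//.
apply: le_trans (normc_sum _ _) _.
have -> : k.+1%:R * r ^+ k = \sum_(i < k.+1) r ^+ k.
  by rewrite sumr_const card_ord mulr_natl.
apply: ler_sum => i _; rewrite normcM !normcX.
rewrite (_ : r ^+ k = r ^+ (k.+1.-1 - i) * r ^+ i); last first.
  by rewrite -exprD subnK// -ltnS.
by apply: ler_pM; rewrite ?exprn_ge0 ?normc_ge0// lerXn2r ?nnegrE ?normc_ge0.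
Qed.

(** Induction along [taylor1_powS]. The factor [r] on the left stands in for the exponent [k - 1] on
    the right, which would be awkward at [k = 0]. *)
Lemma normc_taylor1_pow z w (r : R) k : normc z <= r -> normc w <= r ->
  normc (taylor1_pow z w k) * r <= k.+1%:R ^+ 2 * r ^+ k * normc (w - z) ^+ 2.
Proof.
move=> zr wr; have r0 : 0 <= r := le_trans (normc_ge0 _) zr.
elim: k => [|k IH].
  have -> : taylor1_pow z w 0 = 0 by rewrite /taylor1_pow expr0 mulr1 mul1r subrr.
  rewrite normc0 mul0r; apply: mulr_ge0; last exact: sqr_ge0.
  by rewrite expr0 mulr1 sqr_ge0.
rewrite taylor1_powS.
set d := normc (w - z) in IH *.
have d0 : 0 <= d by exact: normc_ge0.
apply: (@le_trans _ _ ((r * normc (taylor1_pow z w k) + k.+1%:R * r ^+ k * d * d) * r)).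
  apply: ler_wpM2r => //; apply: le_trans (normcD _ _) _; rewrite !normcM.
  by apply: lerD; rewrite ler_wpM2r ?normc_ge0// normc_subXX.
apply: (@le_trans _ _ (r * (k.+1%:R ^+ 2 * r ^+ k * d ^+ 2) + k.+1%:R * r ^+ k.+1 * d ^+ 2)).
  rewrite mulrDl; apply: lerD.
    by rewrite -mulrA ler_wpM2l.
  by rewrite exprSr expr2 le_eqVlt; apply/orP; left; apply/eqP; ring.
(* With [m = k + 1], the induction closes because [m ^ 2 + m <= (m + 1) ^ 2]. *)
have : 0 <= r ^+ k.+1 * d ^+ 2 by rewrite mulr_ge0 ?exprn_ge0.
have : 0 <= (k.+1%:R : R) by [].
rewrite -(natr1 k.+1) exprS.
move: (k.+1%:R : R) => m m0; set e := r ^+ k; set e2 := d ^+ 2 => h.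
have : 0 <= m * (r * e * e2) by rewrite mulr_ge0.
nra.
Qed.

Lemma psum_taylor1 b z w n :
  psum b w n.+1 - psum b z n.+1 - (w - z) * psum (dcoef b) z n =
  \sum_(k < n) b k.+1 * taylor1_pow z w k.
Proof.
rewrite /psum 2!big_ord_recl !expr0 /dcoef mulr_sumr.
rewrite opprD addrACA subrr add0r -!sumrB; apply: eq_bigr => k _.
by rewrite /taylor1_pow lift0; ring.
Qed.

(** A quadratic remainder bound, uniform on a closed smaller disk, is what justifies termwise
    differentiation. It holds for partial sums with a constant independent of [n] and survives the
    limit. *)
Lemma sums_to_taylor1 b F F1 (r : R) : subexp b -> sums_to b F ->
  sums_to (dcoef b) F1 -> 0 < r -> r < 1 ->
  exists2 c, 0 <= c & forall z w, normc z <= r -> normc w <= r ->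
    normc (F w - F z - (w - z) * F1 z) <= c * normc (w - z) ^+ 2.
Proof.
move=> hb hF hF1 r0 r1.
have hb2 : subexp (fun k => k.+1%:R * dcoef b k).
  by apply: subexp_natmul; exact: subexp_dcoef.
have [|c hc] := subexp_abs_sum hb2 _ r1; first exact: ltW.
have c0 : 0 <= c by have := hc 0; rewrite big_ord0.
exists (c / r); first by rewrite divr_ge0// ltW.
move=> z w zr wr.
(* Lengths [n.+1] and [n] match because differentiation lowers the degree by one. *)
have bnd n : normc (psum b w n.+1 - psum b z n.+1 - (w - z) * psum (dcoef b) z n)
    <= c / r * normc (w - z) ^+ 2.
  rewrite psum_taylor1; apply: le_trans (normc_sum _ _) _.
  rewrite mulrAC ler_pdivlMr// mulr_suml.
  apply: (@le_trans _ _ ((\sum_(k < n) normc (k.+1%:R * dcoef b k) * r ^+ k) *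
    normc (w - z) ^+ 2)); last by rewrite ler_wpM2r ?sqr_ge0.
  rewrite mulr_suml; apply: ler_sum => k _.
  rewrite /dcoef !normcM !normc_nat -[leLHS]mulrA.
  apply: le_trans (ler_wpM2l (normc_ge0 _) (normc_taylor1_pow k zr wr)) _.
  by rewrite le_eqVlt; apply/orP; left; apply/eqP; ring.
(* The three approximation errors tend to 0, leaving the uniform bound. *)
have cv : (normc (psum b w n.+1 - F w) + normc (psum b z n.+1 - F z) +
    normc (w - z) * normc (psum (dcoef b) z n - F1 z) +
    c / r * normc (w - z) ^+ 2) @[n --> \oo] --> c / r * normc (w - z) ^+ 2.
  have w1 := le_lt_trans wr r1; have z1 := le_lt_trans zr r1.
  rewrite -[X in _ --> X]add0r; apply: cvgD; last exact: cvg_cst.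
  rewrite -[X in _ --> X](addr0 0); apply: cvgD; last first.
    by rewrite -(mulr0 (normc (w - z))); apply: cvgM; first exact: cvg_cst; exact: hF1.
  rewrite -[X in _ --> X](addr0 0); apply: cvgD.
    by have := hF w w1; rewrite -(cvg_shiftS (fun n => normc (psum b w n - F w))).
  by have := hF z z1; rewrite -(cvg_shiftS (fun n => normc (psum b z n - F z))).
apply: (cvgr_to_ge cv).
near=> n.
rewrite [X in normc X](_ : _ = - (psum b w n.+1 - F w) + (psum b z n.+1 - F z)
  + (w - z) * (psum (dcoef b) z n - F1 z) +
  (psum b w n.+1 - psum b z n.+1 - (w - z) * psum (dcoef b) z n)); last by ring.
apply: le_trans (normcD _ _) _; apply: lerD; last exact: bnd.
apply: le_trans (normcD _ _) _; apply: lerD; last by rewrite normcM.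
by apply: le_trans (normcD _ _) _; rewrite normcN.
Unshelve. all: by end_near. Qed.

End PowerSeries.

(** * Termwise complex differentiation and Taylor coefficients of a power series *)

Section Derivative.
Variable R : realType.
Local Notation C := R[i].
Local Notation normc := (@ComplexField.Normc.normc R).
Implicit Types (b : nat -> C) (z w l : C) (F : C^o -> C^o).

Lemma gt0_complexE (e : C) : 0 < e -> exists2 r : R, 0 < r & e = r%:C.
Proof.
move=> e0; have /complex_realP[r er] := gtr0_real e0.
by exists r => //; rewrite -ltcR -er.
Qed.

Lemma nbhs_normcP z (P : C -> Prop) :
  nbhs (z : C^o) P <-> exists2 d : R, 0 < d & forall w, normc (w - z) < d -> P w.
Proof.
split.
  move=> /nbhs_ballP[e /= /gt0_complexE[r r0 ->]] h; exists r => // w wz.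
  by apply: h; rewrite -ball_normE /ball_ /= normC_normc ltcR normc_distC.
move=> [d d0 h]; apply/nbhs_ballP; exists d%:C; first by rewrite /= ltcR.
by move=> w; rewrite -ball_normE /ball_ /= normC_normc ltcR normc_distC => /h.
Qed.

Lemma derive_of_taylor1 F z l (c d : R) : 0 <= c -> 0 < d ->
  (forall w, normc (w - z) < d ->
    normc (F w - F z - (w - z) * l) <= c * normc (w - z) ^+ 2) ->
  derivable F z 1 /\ derive1 F z = l.
Proof.
move=> c0 d0 h.
suff cv : (fun h => h^-1 *: ((F \o shift z) (h *: (1 : C^o)) - F z)) @ (0 : C^o)^' --> (l : C^o).
  split; first by apply/cvg_ex; exists l.
  by rewrite derive1E; exact: cvg_lim.
apply/cvgrPdistC_lt => _ /gt0_complexE[e e0 ->].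
(* The difference quotient is off by at most [c * normc k]; dividing by [c + 1] instead of [c]
   covers the case [c = 0]. *)
have [d1 d10 [d1d d1e]] : exists2 d1, 0 < d1 & d1 <= d /\ c * d1 < e.
  have c1 : 0 < c + 1 by lra.
  exists (Num.min d (e / (c + 1))); first by rewrite lt_min d0 divr_gt0.
  split; first by rewrite ge_min lexx.
  apply: (@le_lt_trans _ _ (c * (e / (c + 1)))); first by rewrite ler_wpM2l// ge_min lexx orbT.
  by rewrite mulrCA gtr_pMr// ltr_pdivrMr//; lra.
apply/nbhs_normcP; exists d1 => // k; rewrite subr0 => kd1 k0.
rewrite normC_normc ltcR /=.
have kn0 : 0 < normc k by rewrite lt_neqAle normc_ge0 andbT eq_sym; apply/eqP => /normc_eq0/eqP; exact/negP.
rewrite [k%:A](mulr1).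
have := h (k + z); rewrite addrK => /(_ (lt_le_trans kd1 d1d)) hk.
rewrite [X in normc X](_ : _ = k^-1 * (F (k + z) - F z - k * l)); last first.
  by rewrite [RHS]mulrBr mulrA mulVf ?mul1r.
rewrite normcM -(ltr_pM2l kn0) mulrA -normcM mulfV// -(rmorph1 (real_complex R)) normc_real normr1 mul1r.
apply: le_lt_trans hk _; rewrite expr2 mulrCA ltr_pM2l//.
by apply: le_lt_trans d1e; rewrite ler_wpM2l// ltW.
Qed.

Lemma sums_to_derive b F : subexp b -> sums_to b F ->
  holo_on (@udisk R) F /\ sums_to (dcoef b) (derive1 F).
Proof.
move=> hb hF.
(* Choice needs a witness at every point, so 0 is supplied outside the disk. *)
have /choice[F1 hF1] z : exists s : C, normc z < 1 ->
    normc (psum (dcoef b) z n - s) @[n --> \oo] --> (0 : R).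
  have [z1|z1] := pselect (normc z < 1); last by exists 0 => /z1.
  by have [s hs] := psum_cvg (subexp_dcoef hb) z1; exists s.
have hd z : normc z < 1 -> derivable F z 1 /\ derive1 F z = F1 z.
  move=> z1; have [r zr r1] := between z1.
  have r0 : 0 < r by apply: le_lt_trans zr; exact: normc_ge0.
  have [c c0 hc] := sums_to_taylor1 hb hF hF1 r0 r1.
  (* The radius [r - normc z] keeps [w] inside the closed disk of radius [r], where the remainder
     bound applies. *)
  apply: (@derive_of_taylor1 F z (F1 z) c (r - normc z)) => //; first by rewrite subr_gt0.
  move=> w wz; apply: hc; first exact: ltW.
  by rewrite -[w](subrK z) (le_trans (normcD _ _))// -lerBrDr ltW.
split; first by move=> z /udiskE /hd[].
by move=> z z1; rewrite (hd z z1).2; exact: hF1.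
Qed.

Lemma sums_to_taylor_coef b F k : subexp b -> sums_to b F -> taylor_coef F k = b k.
Proof.
suff E : subexp b -> sums_to b F -> derive1n k F 0 = k`!%:R * b k.
  move=> hb hF; by rewrite /taylor_coef E// mulrAC mulfV ?mul1r// pnatr_eq0 -lt0n fact_gt0.
(* Both [b] and [F] vary, since the induction passes to [dcoef b] and the derivative of [F]. *)
elim: k b F => [|k IH] b F hb hF.
  have /hF : normc 0 < 1 by rewrite normc0.
  rewrite -(cvg_shiftS (fun n => normc (psum b 0 n - F 0))) /= => cv.
  apply/eqP; rewrite fact0 mul1r /= eq_sym -subr_eq0; apply/eqP/normc_eq0.
  apply: (cvg_unique _ _ cv) => //.
  (* At 0 every nonempty partial sum equals [b 0]. *)
  rewrite (_ : (fun n => _) = cst (normc (b 0%N - F 0))); first exact: cvg_cst.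
  apply/funext => n; rewrite /psum big_ord_recl expr0 mulr1 big1 ?addr0// => i _.
  by rewrite lift0 exprS mul0r mulr0.
have [_ hF'] := sums_to_derive hb hF.
rewrite /derive1n iterSr; have := IH _ _ (subexp_dcoef hb) hF'; rewrite /derive1n => ->.
by rewrite /dcoef factS natrM mulrA [X in X * _]mulrC.
Qed.

End Derivative.

(** * Integrals over a period, and continuous functions whose trigonometric moments vanish *)

Section CircleIntegral.
Variable R : realType.
Local Notation mu := (@lebesgue_measure R).
Local Notation period := (`[0%R, pi *+ 2] : set R).
Implicit Types (u v : R -> R).

Lemma continuous_integrable_period u : continuous u ->
  mu.-integrable period (EFin \o u).
Proof.
move=> cu; apply: continuous_compact_integrable; first exact: segment_compact.
exact: continuous_subspaceT.
Qed.

Lemma continuous_bounded_period u : continuous u ->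
  exists M, forall t, period t -> `|u t| <= M.
Proof.
move=> cu; have p0 : (0 : R) <= pi *+ 2 by rewrite mulrn_wge0// pi_ge0.
have [|c _ hc] := @EVT_max _ (fun t => `|u t|) _ _ p0.
  by apply: continuous_subspaceT => t; apply: cvg_norm; exact: cu.
by exists `|u c| => t /= /hc.
Qed.

Lemma Rintegral_period_cst (c : R) : \int[mu]_(t in period) c = c * (pi *+ 2).
Proof.
rewrite Rintegral_cst//= lebesgue_measure_itv/= lte_fin.
by rewrite pmulrn_lgt0// pi_gt0 oppr0 addr0.
Qed.

Lemma Rintegral_period_restrict (c a b : R) : 0 <= a -> a < b -> b <= pi *+ 2 ->
  mu.-integrable period (EFin \o (cst c \_ `[a, b])) /\
  \int[mu]_(t in period) (cst c \_ `[a, b]) t = c * (b - a).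
Proof.
move=> a0 ab bp; have sub : period `&` `[a, b] = `[a, b].
  apply/setIidr => t /=; rewrite !in_itv /= => /andP[at_ tb].
  by rewrite (le_trans a0 at_) (le_trans tb bp).
split; last first.
  rewrite -Rintegral_mkcondr sub Rintegral_cst//= lebesgue_measure_itv/= lte_fin ab.
  by rewrite -EFinB.
rewrite -restrict_EFin; apply/integrable_restrict => //; rewrite sub.
apply: continuous_compact_integrable; first exact: segment_compact.
by apply: continuous_subspaceT => t; exact: cvg_cst.
Qed.

(** Reduces estimates on both sides of [pi] to the monotonicity of cosine on [[0, pi]]. *)
Lemma cos_dist_pi (t : R) : cos t = - cos `|t - pi|.
Proof. by rewrite cos_norm cosB cospi sinpi mulr0 addr0 mulrN1 opprK. Qed.

Lemma continuous_mul_trigX u (a : R) N : continuous u ->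
  continuous (fun t => u t * (a - cos t) ^+ N).
Proof.
move=> cu t; apply: cvgM; first exact: cu.
apply: (@continuous_comp _ _ _ (fun t => a - cos t) (fun x => x ^+ N)).
  by apply: cvgB; [exact: cvg_cst|exact: continuous_cos].
exact: exprn_continuous.
Qed.

(* The trigonometric polynomial [1 - cos d - cos t] exceeds 1 near [t = pi] and
   is bounded by 1 in absolute value away from it, so its powers concentrate there. *)
Lemma trig_moments_gt0 u : continuous u -> 0 < u pi ->
  (forall a N, \int[mu]_(t in period) (u t * (a - cos t) ^+ N) = 0) -> False.
Proof.
move=> cu u0 h; pose c := u pi / 2.
have c0 : 0 < c by rewrite /c; lra.
have [d d0 hd] : exists2 d, 0 < d & forall t, `|t - pi| <= d -> c <= u t.
  have /cvgrPdist_lt/(_ _ c0)/nbhs_ballP[e /= e0 he] := cu pi.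
  exists (e / 2); first by lra.
  move=> t ht; have := he t; rewrite /ball /= distrC.
  have -> : `|t - pi| < e by lra.
  by move=> /(_ isT); rewrite ltr_norml /c => /andP[]; lra.
(* Since [pi >= 2], this puts the interval of half-width [d / 2] around [pi] inside the period, and
   [d] inside [[0, pi]]. *)
wlog d1 : d d0 hd / d <= 1.
  move=> /(_ (Num.min d 1)); rewrite lt_min d0 ltr01 ge_min lexx orbT; apply => // t.
  by rewrite le_min => /andP[/hd].
have pi2 : (2 : R) <= pi := pi_ge2 R.
have [M hM] := continuous_bounded_period cu.
have M0 : 0 <= M.
  apply: le_trans (hM pi _); first exact: normr_ge0.
  by rewrite /= in_itv /=; apply/andP; split; lra.
have lecos (s t : R) : 0 <= s -> s <= t -> t <= pi -> cos t <= cos s.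
  move=> s0 st tp; move: st; rewrite le_eqVlt => /predU1P[->//|st].
  by rewrite ltW// ltr_cos ?in_itv//=; apply/andP; split; lra.
(* The gain over 1 of [1 - cos d - cos t] at distance at most [d / 2] from [pi]. *)
pose eta := cos (d / 2) - cos d.
have eta0 : 0 < eta.
  by rewrite subr_gt0 ltr_cos ?in_itv//=; try (apply/andP; split); lra.
pose a := 1 - cos d.
(* Three zones by distance to [pi]: up to [d / 2] the integrand is at least [c * (1 + eta) ^+ N], up
   to [d] it is nonnegative, and beyond [d] it is at least [- M]. *)
have key N t : period t ->
    (cst (c * (1 + eta) ^+ N) \_ `[pi - d / 2, pi + d / 2]) t - M <= u t * (a - cos t) ^+ N.
  move=> pt; have uM := hM t pt.
  set s := `|t - pi|.
  have s0 : 0 <= s by exact: normr_ge0.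
  have sp : s <= pi.
    by move: pt; rewrite /= in_itv /= /s ler_norml => /andP[? ?]; apply/andP; split; lra.
  have aE : a - cos t = 1 + (cos s - cos d) by rewrite cos_dist_pi -/s /a; lra.
  rewrite patchE /=; case: ifPn => [|_].
    rewrite inE /= in_itv /= => /andP[t1 t2].
    have sd : s <= d / 2 by rewrite /s ler_norml; apply/andP; split; lra.
    have ut : c <= u t by apply: hd; rewrite -/s; lra.
    have le1 : 1 + eta <= a - cos t.
      have dp : d / 2 <= pi by lra.
      by have := lecos _ _ s0 sd dp; rewrite aE /eta; lra.
    have : c * (1 + eta) ^+ N <= u t * (a - cos t) ^+ N.
      apply: ler_pM => //; first exact: ltW.
        by rewrite exprn_ge0//; lra.
      by rewrite lerXn2r// nnegrE; lra.
    by rewrite ?sub0r; lra.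
  have [sd|ds] := leP s d.
    have ut : c <= u t by exact: hd.
    have : 0 <= u t * (a - cos t) ^+ N.
      apply: mulr_ge0; first lra.
      have dp : d <= pi by lra.
      by rewrite exprn_ge0// aE; have := lecos _ _ s0 sd dp; lra.
    by rewrite ?sub0r; lra.
  have T1 : `|a - cos t| <= 1.
    rewrite aE ler_norml; have := lecos _ _ (ltW d0) (ltW ds) sp.
    by have := cos_geN1 s; have := cos_le1 d; move=> ? ? ?; apply/andP; split; lra.
  have : `|u t * (a - cos t) ^+ N| <= M.
    rewrite normrM normrX -[leRHS]mulr1; apply: ler_pM => //.
    by rewrite exprn_ile1.
  by rewrite ler_norml sub0r => /andP[].
have bnd N : c * (1 + eta) ^+ N * d <= M * (pi *+ 2).
  have [||| intI intE] := @Rintegral_period_restrict (c * (1 + eta) ^+ N) (pi - d / 2) (pi + d / 2).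
  - by lra.
  - by lra.
  - by lra.
  have intM : mu.-integrable period (EFin \o cst M).
    by apply: continuous_integrable_period => t; exact: cvg_cst.
  have intT : mu.-integrable period (EFin \o (fun t => u t * (a - cos t) ^+ N)).
    exact/continuous_integrable_period/continuous_mul_trigX.
  have := @le_Rintegral _ _ _ mu period
    (fun t => (cst (c * (1 + eta) ^+ N) \_ `[pi - d / 2, pi + d / 2]) t - M)
    (fun t => u t * (a - cos t) ^+ N) _ _ intT (key N).
  rewrite h RintegralB// intE Rintegral_period_cst.
  rewrite (_ : pi + d / 2 - (pi - d / 2) = d); last by lra.
  rewrite subr_le0; apply => //.
  exact: (integrableB _ intI intM).
(* By Bernoulli the left side of [bnd] grows at least like [N * (c * eta * d)], so any integer [N]
   above [x] contradicts it. *)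
pose x := M * (pi *+ 2) / (c * eta * d).
have ced : 0 < c * eta * d by rewrite !mulr_gt0.
have x0 : 0 <= x.
  apply: divr_ge0; last exact: ltW.
  by apply: mulr_ge0 => //; rewrite mulrn_wge0// pi_ge0.
have := archi_boundP x0; rewrite ltNge => /negP; apply.
rewrite /x ler_pdivlMr//; apply: le_trans (bnd (Num.bound x)).
rewrite (_ : _ * (c * eta * d) = c * ((Num.bound x)%:R * eta) * d); last by ring.
rewrite ler_wpM2r ?(ltW d0)// ler_wpM2l ?(ltW c0)//.
by apply: le_trans (bernoulli _ (ltW eta0)); rewrite lerDr.
Qed.

(** The moment condition is stable under negation, so either sign of [u pi] is excluded by
    [trig_moments_gt0]. *)
Lemma trig_moments_eq0 u : continuous u ->
  (forall a N, \int[mu]_(t in period) (u t * (a - cos t) ^+ N) = 0) -> u pi = 0.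
Proof.
move=> cu h; apply/eqP; case: (ltgtP (u pi) 0) => // u0; exfalso; last first.
  exact: (trig_moments_gt0 cu u0 h).
apply: (@trig_moments_gt0 (fun t => - u t)); first by move=> t; apply: cvgN; exact: cu.
  by rewrite oppr_gt0.
move=> a N; under eq_Rintegral do rewrite mulNr -mulN1r.
rewrite RintegralZl ?h ?mulr0//; exact/continuous_integrable_period/continuous_mul_trigX.
Qed.

End CircleIntegral.

(** * Complex means over a period and orthogonality of the characters *)

Section Fourier.
Variable R : realType.
Local Notation C := R[i].
Local Notation mu := (@lebesgue_measure R).
Local Notation period := (`[0%R, pi *+ 2] : set R).
Local Notation normc := (@ComplexField.Normc.normc R).
Implicit Types (h g : R -> C) (t : R) (z w : C) (k : int).

(** Continuity is stated by components because [cint] integrates by components; [ccontP] recovers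
    the topological form, used for sums and products. *)
Definition ccont h : Prop :=
  continuous (fun t => complex.Re (h t)) /\ continuous (fun t => complex.Im (h t)).

Lemma ccontP h : ccont h <-> continuous (h : R -> C^o).
Proof.
split=> [[cRe cIm] t|ch]; last first.
  split=> t; apply/cvgrPdist_lt => e e0.
    have ec : (0 : C) < e%:C by rewrite ltcR.
    have /cvgrPdist_lt/(_ _ ec) := ch t; apply: filterS => s.
    rewrite normC_normc ltcR; apply: le_lt_trans.
    by rewrite -raddfB; exact: normc_Re.
  have ec : (0 : C) < e%:C by rewrite ltcR.
  have /cvgrPdist_lt/(_ _ ec) := ch t; apply: filterS => s.
  rewrite normC_normc ltcR; apply: le_lt_trans.
  by rewrite -raddfB; exact: normc_Im.
apply/cvgrPdist_lt => _ /gt0_complexE[e e0 ->].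
have e2 : 0 < e / 2 by lra.
have /cvgrPdist_lt/(_ _ e2) hRe := cRe t.
have /cvgrPdist_lt/(_ _ e2) hIm := cIm t.
near=> s; rewrite normC_normc ltcR; apply: le_lt_trans (normc_le_ReIm _) _.
rewrite !raddfB (splitr e); apply: ltrD; near: s; [exact: hRe|exact: hIm].
Unshelve. all: by end_near. Qed.

Lemma expiD s t : expi (s + t) = expi s * expi t.
Proof. by rewrite /expi cosD sinD; congr (_ +i* _); rewrite addrC. Qed.

Lemma expi0 : expi 0 = 1 :> C.
Proof. by rewrite /expi cos0 sin0. Qed.

Lemma normc_expi t : normc (expi t) = 1.
Proof. by rewrite /= cos2Dsin2 sqrtr1. Qed.

Lemma expi_nat n t : expi (n%:R * t) = expi t ^+ n.
Proof.
elim: n => [|n IH]; first by rewrite mul0r expi0.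
by rewrite -natr1 mulrDl mul1r expiD IH exprSr.
Qed.

Lemma expi_period k : expi (k%:~R * (pi *+ 2)) = 1 :> C.
Proof.
have E n : expi (n%:R * (pi *+ 2)) = 1 :> C.
  by rewrite expi_nat /expi cos2pi sin2pi expr1n.
case: k => n; first exact: E.
rewrite NegzE mulrNz mulNr.
by rewrite -[LHS]mulr1 -(E n.+1) -expiD addNr expi0.
Qed.

Lemma ccont_expi (c : R) : ccont (fun t => expi (c * t)).
Proof.
split=> t.
  apply: (@continuous_comp _ _ _ (fun t => c * t) (@cos R)); last exact: continuous_cos.
  exact: mulrl_continuous.
apply: (@continuous_comp _ _ _ (fun t => c * t) (@sin R)); last exact: continuous_sin.
exact: mulrl_continuous.
Qed.

Lemma ccont_cst (c : C) : ccont (fun=> c).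
Proof. by split=> t; exact: cvg_cst. Qed.

Lemma ccontD h g : ccont h -> ccont g -> ccont (fun t => h t + g t).
Proof.
move=> /ccontP ch /ccontP cg; apply/ccontP => t.
by apply: (@cvgD _ C^o); [exact: ch|exact: cg].
Qed.

Lemma ccontM h g : ccont h -> ccont g -> ccont (fun t => h t * g t).
Proof.
move=> /ccontP ch /ccontP cg; apply/ccontP => t.
by apply: (@cvgM C); [exact: ch|exact: cg].
Qed.

Lemma ccontZ (c : C) h : ccont h -> ccont (fun t => c * h t).
Proof. exact/ccontM/ccont_cst. Qed.

Lemma ccontB h g : ccont h -> ccont g -> ccont (fun t => h t - g t).
Proof.
move=> /ccontP ch /ccontP cg; apply/ccontP => t.
by apply: (@cvgB _ C^o); [exact: ch|exact: cg].
Qed.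

Lemma cint_cintegrable h : ccont h -> cintegrable h.
Proof. by move=> [cRe cIm]; split; exact: continuous_integrable_period. Qed.

Lemma cintD h g : ccont h -> ccont g ->
  cint (fun t => h t + g t) = cint h + cint g.
Proof.
move=> /cint_cintegrable[hr hi] /cint_cintegrable[gr gi].
rewrite /cint; apply/eqP; rewrite eq_complex /=; apply/andP; split; apply/eqP.
  by rewrite -RintegralD//; apply: eq_Rintegral => t _; rewrite raddfD.
by rewrite -RintegralD//; apply: eq_Rintegral => t _; rewrite raddfD.
Qed.

Lemma cintZ (a : C) h : ccont h -> cint (fun t => a * h t) = a * cint h.
Proof.
move=> /cint_cintegrable[]; set u := fun t => complex.Re (h t).
set v := fun t => complex.Im (h t) => hu hv.
have int (c : R) (w : R -> R) : mu.-integrable period (EFin \o w) ->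
    mu.-integrable period (EFin \o (fun t => c * w t)).
  by move=> hw; exact: (integrableZl _ _ hw).
case: a => a b; rewrite /cint -/u -/v; apply/eqP; rewrite eq_complex /=.
apply/andP; split; apply/eqP.
  rewrite -!RintegralZl// -RintegralB//; [|exact: int|exact: int].
  by apply: eq_Rintegral => t _; rewrite /u /v; case: (h t).
rewrite -!RintegralZl// -RintegralD//; [|exact: int|exact: int].
by apply: eq_Rintegral => t _; rewrite /u /v; case: (h t).
Qed.

Lemma Rintegral_period_le (u : R -> R) (M : R) : continuous u ->
  (forall t, period t -> `|u t| <= M) -> `|\int[mu]_(t in period) u t| <= M * (pi *+ 2).
Proof.
move=> cu hM; have iu := continuous_integrable_period cu.
apply: le_trans (le_normr_Rintegral _ iu) _ => //.
rewrite -Rintegral_period_cst; apply: le_Rintegral => //.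
  by apply: (@continuous_integrable_period _ (fun t => `|u t|)) => t; apply: cvg_norm; exact: cu.
by apply: continuous_integrable_period => t; exact: cvg_cst.
Qed.

(** The factor 2 comes from bounding the real and imaginary parts separately; only boundedness and
    limits equal to 0 depend on it later. *)
Lemma normc_cint_le h (M : R) : ccont h ->
  (forall t, period t -> normc (h t) <= M) -> normc (cint h) <= 2 * M * (pi *+ 2).
Proof.
move=> [cRe cIm] hM; apply: le_trans (normc_le_ReIm _) _ => /=.
rewrite -mulrA mulr_natl mulr2n; apply: lerD; apply: Rintegral_period_le => // t /hM.
  exact/le_trans/normc_Re.
exact/le_trans/normc_Im.
Qed.

(** Normalised exactly as in [abs_conv], so that convolutions in the space are literally means. *)
Definition cmean h : C := (pi *+ 2)^-1%:C * cint h.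

Lemma eq_cmean h g : h =1 g -> cmean h = cmean g.
Proof. by move=> /funext ->. Qed.

Lemma cmeanD h g : ccont h -> ccont g ->
  cmean (fun t => h t + g t) = cmean h + cmean g.
Proof. by move=> ch cg; rewrite /cmean cintD// mulrDr. Qed.

Lemma cmeanZ (a : C) h : ccont h -> cmean (fun t => a * h t) = a * cmean h.
Proof. by move=> ch; rewrite /cmean cintZ// mulrCA. Qed.

Lemma cmeanB h g : ccont h -> ccont g ->
  cmean (fun t => h t - g t) = cmean h - cmean g.
Proof.
move=> ch cg; rewrite -(mulN1r (cmean g)) -cmeanZ// -cmeanD//; last exact: ccontZ.
by apply: eq_cmean => t; rewrite mulN1r.
Qed.

Lemma normc_cmean_le h (M : R) : ccont h ->
  (forall t, period t -> normc (h t) <= M) -> normc (cmean h) <= 2 * M.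
Proof.
move=> ch hM; have p0 : (0 : R) < pi *+ 2 by rewrite pmulrn_lgt0// pi_gt0.
rewrite /cmean normcM normc_real ger0_norm ?invr_ge0 ?(ltW p0)//.
by rewrite mulrC ler_pdivrMr// normc_cint_le.
Qed.

Lemma cmean0 : cmean (fun=> 0) = 0.
Proof.
have -> : cmean (fun=> 0) = cmean (fun=> 0 * (0 : C)) by rewrite mulr0.
by rewrite cmeanZ ?mul0r//; exact: ccont_cst.
Qed.

Lemma cmean_sum n (b : 'I_n -> C) (g : 'I_n -> R -> C) :
  (forall i, ccont (g i)) ->
  cmean (fun t => \sum_(i < n) b i * g i t) = \sum_(i < n) b i * cmean (g i).
Proof.
have csum n' (b' : 'I_n' -> C) (g' : 'I_n' -> R -> C) :
    (forall i, ccont (g' i)) -> ccont (fun t => \sum_(i < n') b' i * g' i t).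
  move=> cg'; elim: n' b' g' cg' => [|n' IH] b' g' cg'.
    by under eq_fun do rewrite big_ord0; exact: ccont_cst.
  under eq_fun do rewrite big_ord_recr /=.
  by apply: ccontD; [exact: IH|exact: ccontZ].
elim: n b g => [|n IH] b g cg.
  by rewrite big_ord0 -[RHS]cmean0; apply: eq_cmean => t; rewrite big_ord0.
rewrite big_ord_recr /= -IH// -cmeanZ// -cmeanD; [|exact: csum|exact: ccontZ].
by apply: eq_cmean => t; rewrite big_ord_recr.
Qed.

Lemma Rintegral_period_deriv (u v : R -> R) : continuous u ->
  (forall t, is_derive t 1 v (u t)) -> v (pi *+ 2) = v 0 ->
  \int[mu]_(t in period) u t = 0.
Proof.
move=> cu dv v0; rewrite /Rintegral (@continuous_FTC2 _ _ v).
- by rewrite v0 subee.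
- by rewrite pmulrn_lgt0// pi_gt0.
- exact: continuous_subspaceT.
- have cv t : {for t, continuous v}.
    by apply/differentiable_continuous/derivable1_diffP; exact: ex_derive.
  split; first by move=> t _; exact: ex_derive.
    exact/cvg_at_right_filter/cv.
  exact/cvg_at_left_filter/cv.
- by move=> t _; rewrite derive1E; exact: derive_val.
Qed.

(** For [k != 0] the components have antiderivatives [sin (k t) / k] and [- cos (k t) / k], which
    are periodic. *)
Lemma cmean_expi k : cmean (fun t => expi (k%:~R * t)) = (k == 0)%:R.
Proof.
have p0 : (0 : R) < pi *+ 2 by rewrite pmulrn_lgt0// pi_gt0.
have [->|k0] := eqVneq.
  rewrite /cmean (_ : cint _ = (pi *+ 2)%:C).
    by rewrite -rmorphM mulVf ?gt_eqF.
  rewrite /cint /=; apply/eqP; rewrite eq_complex /=; apply/andP; split; apply/eqP.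
    rewrite -[RHS]mul1r -Rintegral_period_cst; apply: eq_Rintegral => t _.
    by rewrite mul0r cos0.
  rewrite -[RHS](mul0r (pi *+ 2)) -Rintegral_period_cst; apply: eq_Rintegral => t _.
  by rewrite mul0r sin0.
have kR : k%:~R != 0 :> R by rewrite intr_eq0.
have [cRe cIm] := @ccont_expi k%:~R.
have [cosp sinp] : cos (k%:~R * (pi *+ 2)) = 1 :> R /\ sin (k%:~R * (pi *+ 2)) = 0 :> R.
  by have [] := expi_period k.
have ds t : is_derive t 1 (fun t => k%:~R^-1 * sin (k%:~R * t)) (cos (k%:~R * t)).
  by apply: is_derive_eq; rewrite /GRing.scale /=; field.
have dc t : is_derive t 1 (fun t => - (k%:~R^-1 * cos (k%:~R * t))) (sin (k%:~R * t)).
  by apply: is_derive_eq; rewrite /GRing.scale /=; field.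
rewrite /cmean.
have -> : cint (fun t => expi (k%:~R * t)) = 0.
  rewrite /cint /= (Rintegral_period_deriv cRe ds); last by rewrite sinp !mulr0 sin0 mulr0.
  by rewrite (Rintegral_period_deriv cIm dc)// cosp mulr0 cos0.
by rewrite mulr0.
Qed.

End Fourier.

(** * Fourier coefficients on circles and the power series they determine *)

Section FourierSeries.
Variable R : realType.
Local Notation C := R[i].
Local Notation period := (`[0%R, pi *+ 2] : set R).
Local Notation normc := (@ComplexField.Normc.normc R).
Implicit Types (b : nat -> C) (h : R -> C) (F s : C -> C) (t : R) (z w : C) (k : int).

(** Extension by 0 to negative indices. Applied to the coefficients and to the powers of [z] alike,
    it lets one formula cover all integer frequencies. *)
Definition zcoef b k : C := if k is Posz j then b j else 0.

Definition fourier h k : C := cmean (fun t => h t * expi ((- k)%:~R * t)).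

Lemma ccont_mul_expi h k : ccont h ->
  ccont (fun t => h t * expi ((- k)%:~R * t)).
Proof. by move=> ch; apply: ccontM => //; exact: ccont_expi. Qed.

Lemma ccont_circle F z : holo_on (@udisk R) F -> normc z < 1 ->
  ccont (fun t => F (z * expi t)).
Proof.
move=> hF z1.
have cz : ccont (fun t => z * expi t).
  apply: ccontZ; have -> : @expi R = (fun t => expi (1 * t)).
    by apply/funext => u; rewrite mul1r.
  exact: ccont_expi.
move/ccontP in cz; apply/ccontP => t.
apply: (@continuous_comp _ C^o C^o (fun t => z * expi t) F); first exact: cz.
apply/differentiable_continuous/derivable1_diffP/hF/udiskE.
by rewrite normcM normc_expi mulr1.
Qed.

Lemma ccont_psum_circle b z n : ccont (fun t => psum b (z * expi t) n).
Proof.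
elim: n => [|n IH].
  by under eq_fun do rewrite /psum big_ord0; exact: ccont_cst.
have -> : (fun t => psum b (z * expi t) n.+1) =
    (fun t => psum b (z * expi t) n + b n * z ^+ n * expi (n%:R * t)).
  by apply/funext => s; rewrite /psum big_ord_recr /= exprMn expi_nat mulrA.
by apply: ccontD => //; apply: ccontZ; exact: ccont_expi.
Qed.

Lemma fourier_psum b z n k :
  fourier (fun t => psum b (z * expi t) n) k =
  \sum_(i < n) b i * z ^+ i * (i%:Z == k)%:R.
Proof.
transitivity (cmean (fun t =>
    \sum_(i < n) (b i * z ^+ i) * expi ((i%:Z - k)%:~R * t))).
  apply: eq_cmean => t; rewrite /psum mulr_suml; apply: eq_bigr => i _.
  by rewrite exprMn intrD mulrDl expiD -expi_nat !mulrA.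
rewrite cmean_sum; last by move=> i; exact: ccont_expi.
by apply: eq_bigr => i _; rewrite cmean_expi subr_eq0.
Qed.

(** The hypothesis says that truncation at [n] loses nothing at frequency [k]. It serves both for
    polynomials, whose later coefficients vanish, and for [n] beyond [k], where it is vacuous. *)
Lemma fourier_psum_full b z n k : (forall j : nat, k = j -> (n <= j)%N -> b j = 0) ->
  fourier (fun t => psum b (z * expi t) n) k = zcoef b k * zcoef (fun j => z ^+ j) k.
Proof.
rewrite fourier_psum; case: k => [j|j] hb; last first.
  by rewrite mul0r big1// => i _; rewrite mulr0.
rewrite /=; have [jn|nj] := ltnP j n.
  rewrite (bigD1 (Ordinal jn))//= eqxx mulr1 big1 ?addr0// => i.
  rewrite -val_eqE /= => ij; by rewrite eqz_nat (negbTE ij) mulr0.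
rewrite hb// mul0r big1// => i _.
by rewrite eqz_nat ltn_eqF ?mulr0// (leq_trans (ltn_ord i)).
Qed.

Lemma normc_fourier_le h k (M : R) : ccont h ->
  (forall t, period t -> normc (h t) <= M) -> normc (fourier h k) <= 2 * M.
Proof.
move=> ch hM; apply: normc_cmean_le; first exact: ccont_mul_expi.
by move=> t /hM; rewrite normcM normc_expi mulr1.
Qed.

Lemma fourierB h1 h2 k : ccont h1 -> ccont h2 ->
  fourier (fun t => h1 t - h2 t) k = fourier h1 k - fourier h2 k.
Proof.
move=> c1 c2; rewrite /fourier -cmeanB; [|exact: ccont_mul_expi..].
by apply: eq_cmean => t; rewrite mulrBl.
Qed.

(** Weierstrass test: the error is at most the tail of the absolute series at radius [r]. *)
Lemma sums_to_uniform b s (r : R) : subexp b -> sums_to b s -> 0 <= r -> r < 1 ->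
  exists2 e : nat -> R, e n @[n --> \oo] --> (0 : R) &
    forall w n, normc w <= r -> normc (psum b w n - s w) <= e n.
Proof.
move=> hb hs r0 r1; pose A := series (fun j => normc (b j) * r ^+ j).
have ndA : nondecreasing_seq A.
  by apply/nondecreasing_seqP => n; rewrite /A seriesS lerDr mulr_ge0 ?normc_ge0 ?exprn_ge0.
have cvA : cvgn A.
  apply: nondecreasing_is_cvgn => //.
  have [c hc] := subexp_abs_sum hb r0 r1.
  by exists c => _ [n _ <-]; rewrite /A seriesEord; exact: hc.
exists (fun n => limn A - A n).
  by rewrite -(subrr (limn A)); apply: cvgB => //; exact: cvg_cst.
move=> w n wr.
have w1 := le_lt_trans wr r1.
have cv : (limn A - A n) + normc (psum b w m - s w) @[m --> \oo] --> limn A - A n.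
  by rewrite -[X in _ --> X]addr0; apply: cvgD; [exact: cvg_cst|exact: hs].
apply: (cvgr_to_ge cv); near=> m.
have nm : (n <= m)%N by near: m; exact: nbhs_infty_ge.
have -> : psum b w n - s w = (psum b w n - psum b w m) + (psum b w m - s w) by ring.
apply: le_trans (normcD _ _) _; rewrite lerD2r normc_distC.
apply: (@le_trans _ _ (A m - A n)); last by rewrite lerD2r nondecreasing_cvgn_le.
have E (V : zmodType) (f : nat -> V) : \sum_(j < m) f j - \sum_(j < n) f j = \sum_(n <= j < m) f j.
  by apply/eqP; rewrite subr_eq addrC -!(big_mkord xpredT) -big_cat_nat.
rewrite /psum /A !seriesEord /= (E C (fun j => b j * w ^+ j)) (E R (fun j => normc (b j) * r ^+ j)).
elim/big_ind2 : _ => [|x1 y1 x2 y2 h1 h2|k _]; first by rewrite normc0.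
  by apply: le_trans (normcD _ _) _; exact: lerD.
by rewrite normcM normcX ler_wpM2l ?normc_ge0// lerXn2r ?nnegrE ?normc_ge0.
Unshelve. all: by end_near. Qed.

(** Uniform convergence on the circle lets the coefficients of the partial sums pass to the limit;
    they are already constant once [n] exceeds the absolute value of [k]. *)
Lemma fourier_sums_to b s z k : subexp b -> sums_to b s -> normc z < 1 ->
  fourier (fun t => s (z * expi t)) k = zcoef b k * zcoef (fun j => z ^+ j) k.
Proof.
move=> hb hs z1; have [hd _] := sums_to_derive hb hs.
have [e e0 he] := sums_to_uniform hb hs (normc_ge0 z) z1.
apply/eqP; rewrite eq_sym -subr_eq0; apply/eqP/normc_eq0.
apply/eqP; rewrite eq_le normc_ge0 andbT.
have cv : 2 * e n @[n --> \oo] --> (0 : R).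
  by rewrite -(mulr0 2); apply: cvgM => //; exact: cvg_cst.
apply: (cvgr_to_ge cv); near=> n.
rewrite -(@fourier_psum_full _ _ n); last first.
  move=> j kj nj; exfalso; move: nj; apply/negP; rewrite -ltnNge.
  have -> : j = `|k|%N by rewrite kj.
  by near: n; exact: nbhs_infty_gt.
rewrite -fourierB; [|exact: ccont_psum_circle|exact: ccont_circle].
apply: normc_fourier_le.
  by apply: ccontB; [exact: ccont_psum_circle|exact: ccont_circle].
by move=> t _; apply: he; rewrite normcM normc_expi mulr1.
Unshelve. all: by end_near. Qed.

(** Multiplication by cosine only shifts frequencies by one, so all products of [h] with powers of
    [a - cos t] also have zero mean. The moment lemma then gives vanishing at [pi]; other points are
    reached by rotating the circle. *)
Lemma fourier_unique h : ccont h -> (forall k, fourier h k = 0) -> h pi = 0.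
Proof.
move=> ch h0.
have cexp k : ccont (fun t => expi (k%:~R * t)) by exact: ccont_expi.
have cT (a : R) N : ccont (fun t => h t * ((a - cos t) ^+ N)%:C).
  apply: ccontM => //; split.
    have c1 : continuous (fun _ : R => 1 : R) by move=> t; exact: cvg_cst.
    have := @continuous_mul_trigX R _ a N c1.
    by under eq_fun do rewrite mul1r.
  by move=> t; exact: cvg_cst.
have cTe (a : R) N k : ccont (fun t => h t * ((a - cos t) ^+ N)%:C * expi (k%:~R * t)).
  exact: ccontM.
(* All frequencies are carried through the induction, since frequency [k] at exponent [N.+1]
   involves [k], [k + 1] and [k - 1] at exponent [N]. *)
have key (a : R) N k : cmean (fun t => h t * ((a - cos t) ^+ N)%:C * expi (k%:~R * t)) = 0.
  elim: N k => [|N IH] k.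
    rewrite -(h0 (- k)) /fourier opprK; apply: eq_cmean => t.
    by rewrite expr0 mulr1.
  pose g k t : C := h t * ((a - cos t) ^+ N)%:C * expi (k%:~R * t).
  have cg j : ccont (g j) by exact: cTe.
  have cZ (c : C) j : ccont (fun t => c * g j t) by exact: ccontZ.
  transitivity (cmean (fun t => (a%:C * g k t - 2^-1 * g (k + 1) t) - 2^-1 * g (k - 1) t)).
    apply: eq_cmean => t; rewrite /g.
    have -> : ((a - cos t) ^+ N.+1)%:C =
        (a%:C - 2^-1 * (expi t + expi (- t))) * ((a - cos t) ^+ N)%:C.
      have -> : expi t + expi (- t) = 2 * (cos t)%:C :> C.
        rewrite mulr_natl mulr2n /expi cosN sinN.
        by apply/eqP; rewrite eq_complex /= subrr addr0 !eqxx.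
      by rewrite mulKf ?pnatr_eq0// exprS rmorphM rmorphB.
    have -> : expi ((k + 1)%:~R * t) = expi (k%:~R * t) * expi t.
      by rewrite intrD mulrDl expiD mul1r.
    have -> : expi ((k - 1)%:~R * t) = expi (k%:~R * t) * expi (- t).
      by rewrite intrB mulrBl expiD mul1r.
    by ring.
  rewrite !cmeanB ?cmeanZ//; last by apply: ccontB; exact: cZ.
  by rewrite !IH !mulr0 !subr0.
have [cRe cIm] := ch.
have p0 : (0 : R) < pi *+ 2 by rewrite pmulrn_lgt0// pi_gt0.
(* Frequency 0 of [key], with the normalising factor removed. *)
have cint0 a N : cint (fun t => h t * ((a - cos t) ^+ N)%:C) = 0.
  have /eqP := key a N 0; rewrite mulf_eq0 => /orP[|/eqP <-].
    by rewrite fmorph_eq0 invr_eq0 gt_eqF.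
  by congr cint; apply/funext => t; rewrite mul0r expi0 mulr1.
suff [hRe hIm] : complex.Re (h pi) = 0 /\ complex.Im (h pi) = 0.
  by apply/eqP; rewrite eq_complex /= hRe hIm eqxx.
split; [apply: (trig_moments_eq0 cRe)|apply: (trig_moments_eq0 cIm)] => a N.
  rewrite -[RHS](congr1 (@complex.Re R) (cint0 a N)) /=.
  by apply: eq_Rintegral => t _; case: (h t) => x y /=; rewrite mulr0 subr0.
rewrite -[RHS](congr1 (@complex.Im R) (cint0 a N)) /=.
by apply: eq_Rintegral => t _; case: (h t) => x y /=; rewrite mulr0 add0r.
Qed.

(* Compares [F] with the sum of the power series on the circle through [- z],
   whose point at angle [pi] is [z]. *)
Lemma fourier_sums_to_uniq b F : holo_on (@udisk R) F ->
  (forall z k, normc z < 1 ->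
    fourier (fun t => F (z * expi t)) k = zcoef b k * zcoef (fun j => z ^+ j) k) ->
  subexp b /\ sums_to b F.
Proof.
move=> hF hb.
(* [b k * r ^+ k] is a Fourier coefficient of the bounded function [F] on the circle of radius
   [r]. *)
have sb : subexp b.
  move=> r r0 r1.
  have rn : normc r%:C < 1 by rewrite normc_real ger0_norm.
  have cF := ccont_circle hF rn.
  have [cRe cIm] := cF.
  have [M1 hM1] := continuous_bounded_period cRe.
  have [M2 hM2] := continuous_bounded_period cIm.
  exists (2 * (M1 + M2)) => k.
  have -> : normc (b k) * r ^+ k = normc (b k * r%:C ^+ k).
    by rewrite normcM normcX normc_real ger0_norm.
  have <- := hb r%:C k rn.
  apply: normc_fourier_le => // t pt.
  by apply: le_trans (normc_le_ReIm _) _; apply: lerD; [exact: hM1|exact: hM2].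
split => //.
have /choice[s hs] z : exists s : C, normc z < 1 ->
    normc (psum b z n - s) @[n --> \oo] --> (0 : R).
  have [z1|z1] := pselect (normc z < 1); last by exists 0 => /z1.
  by have [s hs] := psum_cvg sb z1; exists s.
have [hd _] := sums_to_derive sb hs.
move=> z z1; suff -> : F z = s z by exact: hs.
have nz1 : normc (- z) < 1 by rewrite normcN.
have cF := ccont_circle hF nz1.
have cs := ccont_circle hd nz1.
have := @fourier_unique (fun t => F (- z * expi t) - s (- z * expi t)).
have -> : - z * expi pi = z.
  have -> : expi pi = -1 :> C.
    by rewrite /expi cospi sinpi; apply/eqP; rewrite eq_complex /= oppr0 !eqxx.
  by rewrite mulrN1 opprK.
move=> h; apply/eqP; rewrite -subr_eq0; apply/eqP; apply: h.
  by apply: ccontB; [exact: cF|exact: cs].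
by move=> k; rewrite fourierB// hb// (fourier_sums_to _ sb hs)// subrr.
Qed.

End FourierSeries.

(** * Discreteness of the Gaussian integers and the coefficient operators on the space *)

Section IntegerCoefficients.
Variable R : realType.
Local Notation C := R[i].
Local Notation normc := (@ComplexField.Normc.normc R).

Lemma gauss_int_normc_lt1 (a b : C) : gauss_int a -> gauss_int b ->
  normc (a - b) < 1 -> a = b.
Proof.
move=> [x [y ->]] [x' [y' ->]] h.
have small (i j : int) : `|i%:~R - j%:~R : R| < 1 -> i = j.
  rewrite -intrB -intr_norm -[1]/(1%:~R) ltr_int => ij.
  by apply/eqP; rewrite -subr_eq0 -normr_le0 -ltzD1 add0r.
have -> : x = x' by apply: small; apply: le_lt_trans h; exact: (normc_Re (_ +i* _)).
by have -> : y = y' by apply: small; apply: le_lt_trans h; exact: (normc_Im (_ +i* _)).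
Qed.

(** For [m != 0], two multiples closer than the norm of [m] have equal coefficients, so a convergent
    sequence of such multiples is eventually constant. *)
Lemma gauss_int_multiples_closed (X : normedModType C) (y m : X) (c : nat -> C) :
  (forall n, gauss_int (c n)) ->
  (forall e : C, 0 < e -> exists N, forall n, (N <= n)%N -> `|y - c n *: m| < e) ->
  exists b, gauss_int b /\ y = b *: m.
Proof.
move=> hc hy; suff [b hb hyb] : exists2 b, gauss_int b &
    exists N, forall n, (N <= n)%N -> c n *: m = b *: m.
  exists b; split => //; case: hyb => N hN.
  apply/eqP; rewrite -subr_eq0 -normr_eq0; apply/negPn/negP => n0.
  have p0 : 0 < `|y - b *: m| by rewrite lt_neqAle eq_sym n0 normr_ge0.
  have [N' hN'] := hy _ p0.
  have := hN' _ (leq_maxr N N'); rewrite hN ?leq_maxl//.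
  by rewrite ltxx.
have [->|m0] := eqVneq m 0.
  by exists (c 0%N) => //; exists 0%N => n _; rewrite !scaler0.
have mp : 0 < `|m| by rewrite normr_gt0.
have [N hN] := hy (`|m| / 2) (divr_gt0 mp (ltr0Sn _ 1)).
exists (c N) => //; exists N => n Nn; congr (_ *: _).
apply: gauss_int_normc_lt1 => //.
rewrite -ltcR -normC_normc -(ltr_pM2r mp) mul1r -normrZ scalerBl.
have -> : c n *: m - c N *: m = (y - c N *: m) - (y - c n *: m).
  by rewrite opprB [RHS]addrC addrA subrK.
apply: le_lt_trans (ler_normB _ _) _.
by rewrite (splitr `|m|); apply: ltrD; apply: hN.
Qed.

(** Through [abs_entire], this provides the monomial, or 0 for negative [k], as an element of the
    space. *)
Lemma entire_zcoef_pow (k : int) : entire (fun z : C^o => zcoef (fun j => z ^+ j) k).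
Proof.
move=> z; case: k => [[|j]|j]; [exact: derivable_cst| |exact: derivable_cst].
(* Bounds the modulus on the disk of radius 1 around [z], and is positive even at [z = 0]. *)
pose r := normc z + 1.
have r0 : 0 < r by rewrite ltr_wpDl ?normc_ge0.
have [||w wz|//] := @derive_of_taylor1 R (fun w => w ^+ j.+1) z (j.+1%:R * z ^+ j)
    (j.+1%:R ^+ 2 * r ^+ j / r) 1.
- by rewrite divr_ge0 ?(ltW r0)// mulr_ge0 ?sqr_ge0// exprn_ge0// ltW.
- exact: ltr01.
have zr : normc z <= r by rewrite lerDl.
have wr : normc w <= r.
  by rewrite -[w](subrK z) addrC (le_trans (normcD _ _))// lerD2l ltW.
rewrite mulrAC ler_pdivlMr// [X in X - _]/(_ - _) [(w - z) * _]mulrC.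
exact: (normc_taylor1_pow j zr wr).
Qed.

Lemma gauss_int_zcoef (b : nat -> C) k : (forall j, gauss_int (b j)) ->
  gauss_int (zcoef b k).
Proof. by case: k => j h //=; exists 0, 0. Qed.

Lemma horner_psum (p : {poly C}) z : p.[z] = psum (fun j => p`_j) z (size p).
Proof. exact: horner_coef. Qed.

Variables (X : completeNormedModType C) (E : X -> C^o -> C^o).
Hypothesis hX : analytic_banach_space E.

Lemma abs_sub x y z : udisk z -> E (x - y) z = E x z - E y z.
Proof. by move=> Dz; rewrite -scaleN1r (abs_add hX)// (abs_scale hX)// mulN1r. Qed.

(** Convolution with a character: the kernel has modulus 1, so its mean modulus is 1 and the
    operator is a contraction. *)
Lemma abs_fourier x k : exists2 y : X,
  forall z, udisk z -> E y z = fourier (fun t => E x (z * expi t : C)) k & `|y| <= `|x|.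
Proof.
have ck : ccont (fun t : R => expi ((- k)%:~R * t)) by exact: ccont_expi.
have [y [hy yx]] := abs_conv hX x (cint_cintegrable ck).
exists y; first by [].
apply: le_trans yx _.
rewrite (_ : _ * cint _ = 1) ?mul1r//.
rewrite -[RHS](cmean_expi R 0); apply: eq_cmean => t.
by rewrite normC_normc normc_expi mul0r expi0.
Qed.

Lemma fourier_gauss_int f (p : nat -> {poly C}) (q : nat -> X) k :
  (forall n, PnZ n (p n)) ->
  (forall n z, udisk z -> E (q n) z = (p n).[z]) ->
  (fun n => (`|f - q n| : C^o)) @ \oo --> (0 : C^o) ->
  exists b, gauss_int b /\ forall z, normc z < 1 ->
    fourier (fun t => E f (z * expi t : C)) k = b * zcoef (fun j => z ^+ j) k.
Proof.
move=> hp hq cvq.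
have [y hy _] := abs_fourier f k.
have [m hm] := abs_entire hX (@entire_zcoef_pow k).
have [||b [hb yb]] := @gauss_int_multiples_closed X y m (fun n => zcoef (fun j => (p n)`_j) k).
- by move=> n; apply: gauss_int_zcoef; exact: (hp n).2.
- move=> e e0; have /cvgrPdistC_lt/(_ _ e0)[N _ hN] := cvq.
  exists N => n Nn; have := hN n Nn; rewrite /= subr0 normr_id; apply: le_lt_trans.
  (* The image of [f - q n] is [y] minus the multiple of the monomial: the values agree on the disk,
     so [abs_inj] identifies them and contractivity transfers the convergence. *)
  have [yn hyn yn_le] := abs_fourier (f - q n) k.
  rewrite (_ : y - _ = yn)//; apply: (abs_inj hX) => z Dz.
  have z1 : normc z < 1 by exact/udiskE.
  rewrite abs_sub// (abs_scale hX)// hm// hy// hyn//.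
  rewrite -(@fourier_psum_full _ _ _ (size (p n))); last first.
    by move=> j _; exact: nth_default.
  have cf := @ccont_circle R (E f) z (@abs_holo _ _ _ hX f) z1.
  rewrite -fourierB; [|exact: cf|exact: ccont_psum_circle].
  congr (fourier _ k); apply/funext => t.
  have Dt : udisk (z * expi t) by apply/udiskE; rewrite normcM normc_expi mulr1.
  by rewrite abs_sub// hq// horner_psum.
exists b; split => // z z1; have Dz : udisk z by exact/udiskE.
by rewrite -hy// yb (abs_scale hX)// hm.
Qed.

End IntegerCoefficients.

Unset Implicit Arguments.

Theorem theorem5p2 (R : realType) (X : completeNormedModType R[i])
    (E : X -> R[i]^o -> R[i]^o) (hX : analytic_banach_space E) (f : X) :
  (exists (p : nat -> {poly R[i]}) (q : nat -> X),
     (forall n, PnZ n (p n)) /\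
     (forall n z, udisk z -> E (q n) z = (p n).[z]) /\
     ((fun n => (`|f - q n| : R[i]^o)) @ \oo --> (0 : R[i]^o))) ->
  forall k, gauss_int (taylor_coef (E f) k).
Proof.
move=> [p [q [hp [hq cvq]]]] k.
(* The coefficients are chosen for every integer frequency. Only the nonnegative ones form the
   series, as at negative frequencies the monomial factor is 0. *)
have /choice[b hb] := fun j => fourier_gauss_int hX j hp hq cvq.
have [z j z1|sb hF] := @fourier_sums_to_uniq _ (fun j : nat => b j) (E f) (@abs_holo _ _ _ hX f).
  by rewrite (hb j).2//; case: j => // j; rewrite !mulr0.
by rewrite (sums_to_taylor_coef k sb hF); exact: (hb k).1.
Qed.
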